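(* Let $d\ge2$ and let $\mathcal P=\{S_t:t\in I\}$ be a regular one-parameter polynomial family of hyperspheres in $\mathbb R^d$, with incidence hypersurface $Q_{\mathcal P}\subset\mathbb R^d\times I$. Let $\eta_0>0$ be the Elekes–Szabó exponent for $s=d+1$ (as described in the context), and set $\eta=\eta_0/2$. Suppose that there are finite sets $A_1,\ldots,A_d\subset\mathbb R$ and $T_0\subset I$ with $$|A_1|=\cdots=|A_d|=|T_0|=n$$ such that $$|Q_{\mathcal P}\cap(A_1\times\cdots\times A_d\times T_0)|=\Omega(n^{d-\eta}),$$ that is: there are a constant $C>0$ and arbitrarily large integers $n$ for each of which there exist such sets $A_1,\ldots,A_d,T_0$ of cardinality $n$ (depending on $n$) with $|Q_{\mathcal P}\cap(A_1\times\cdots\times A_d\times T_0)|\ge C\,n^{d-\eta}$. Then $\mathcal P$ satisfies one of the following: (i) $\mathcal P$ is a family of concentric hyperspheres (all $S_t$ have the same centre); (ii) $d=2$, and $\mathcal P$ is a family of circles of fixed radius whose centres lie on a line parallel to one of the coordinate axes.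
   Context: A one-parameter polynomial family of hyperspheres in $\mathbb R^d$ is a family $\mathcal P=\{S_t:t\in I\}$, where $I\subset\mathbb R$ is an open interval and $$S_t=\Big\{\bar x\in\mathbb R^d:\sum_{i=1}^d(x_i-a_i(t))^2=R(t)^2\Big\},$$ with $a_1,\ldots,a_d,R\in\mathbb R[t]$ and $R(t)>0$ for every $t\in I$. Its incidence hypersurface is $Q_{\mathcal P}=\{(\bar x,t)\in\mathbb R^d\times I:\bar x\in S_t\}$. The family is regular if $Q_{\mathcal P}$ is smooth and the projection of $Q_{\mathcal P}$ onto any $d$ of the $d+1$ coordinates is finite-to-one. The family $\mathcal P$ is fixed, independent of $n$. Elekes–Szabó exponent: a theorem of Chernikov, Peterzil and Starchenko states the following. Let $s\ge3$ and let $Q\subset\mathbb R^s$ be a semialgebraic set of description complexity at most $D$ (definable by a Boolean combination of at most $D$ polynomial equalities and inequalities of degree at most $D$), such that the projection of $Q$ to any $s-1$ coordinates is finite-to-one. Then exactly one of the following holds: (1) there exist constants $c=c(s,D)>0$ and $\eta_0=\eta_0(s)>0$ such that for all finite sets $A_i\subset\mathbb R$ with $|A_i|=n$ one has $|Q\cap(A_1\times\cdots\times A_s)|\le c\,n^{s-1-\eta_0}$; (2) there exist nonempty open sets $U_i\subset\mathbb R$, an open set $W\subset\mathbb R$ containing $0$, and analytic bijections $\phi_i\colon U_i\to W$ with analytic inverses such that for all $x_i\in U_i$, $(x_1,\ldots,x_s)\in Q\iff\phi_1(x_1)+\cdots+\phi_s(x_s)=0$. The Elekes–Szabó exponent for $s$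 is the exponent $\eta_0=\eta_0(s)$ supplied by this theorem; it depends only on $s$ and not on $Q$, $D$ or $n$. *)

(* Defs.v *)
From HB Require Import structures.
From mathcomp Require Import all_boot all_order all_algebra.
From mathcomp Require Import finmap.
From mathcomp Require Import all_classical all_reals all_analysis.
(* The notations of mpoly clash with those of mathcomp-analysis. *)
From mathcomp Require Import -(notations) mpoly.

Set Implicit Arguments.
Unset Strict Implicit.
Unset Printing Implicit Defensive.

Import Order.TTheory GRing.Theory Num.Theory.
Import numFieldNormedType.Exports.

Local Open Scope classical_set_scope.
Local Open Scope ring_scope.

(* Points of R^s are row vectors 'rV[R]_s; the i-th coordinate of x is x 0 i,
   and col' i x forgets it. *)

Section Grids.
Context {R : realType} {s : nat}.

Definition grid (A : 'I_s -> {fset R}) : set 'rV[R]_s :=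
  [set x | forall i, x 0 i \in A i].

Lemma finite_grid (A : 'I_s -> {fset R}) : finite_set (grid A).
Proof.
pose F (f : {ffun forall i : 'I_s, A i}) : 'rV[R]_s := \row_i val (f i).
apply: (@sub_finite_set _ _ [set F f | f in [set: {dffun forall i : 'I_s, A i}]]).
  move=> x Ax.
  exists [ffun i => [` Ax i]%fset] => //.
  by apply/rowP => i; rewrite mxE ffunE.
by apply: finite_image; exact: finite_finset.
Qed.

(* fset_set returns the empty set on infinite sets; by finite_grid this
   junk value is never used here. *)
Definition grid_count (Q : set 'rV[R]_s) (A : 'I_s -> {fset R}) : nat :=
  #|` fset_set (Q `&` grid A)|%fset.

Definition finite_to_one_projections (Q : set 'rV[R]_s) : Prop :=
  forall (i : 'I_s) (y : 'rV[R]_s.-1), finite_set (Q `&` [set x | col' i x = y]).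

End Grids.

Section Semialgebraic.
Context {R : realType} {s : nat}.

(* p = 0 and p > 0.  The relations p <> 0, p >= 0, p < 0 and p <= 0 are
   Boolean combinations of one such condition on p or on -p. *)
Variant sign_condition : Type :=
  | PolyEq0 of mpoly s R
  | PolyGt0 of mpoly s R.

Definition sc_poly (a : sign_condition) : mpoly s R :=
  match a with PolyEq0 p => p | PolyGt0 p => p end.

Definition sc_holds (a : sign_condition) (x : 'rV[R]_s) : bool :=
  match a with
  | PolyEq0 p => meval (fun i => x 0 i) p == 0
  | PolyGt0 p => 0 < meval (fun i => x 0 i) p
  end.

(* A Boolean combination of m conditions is given by its truth table B.
   mmeasure mdeg p is the total degree of p plus one (and 0 for p = 0). *)
Definition description_complexity_le (D : nat) (Q : set 'rV[R]_s) : Prop :=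
  exists (m : nat) (a : 'I_m -> sign_condition) (B : {ffun 'I_m -> bool} -> bool),
    [/\ (m <= D)%N,
        forall i, (mmeasure mdeg (sc_poly (a i)) <= D.+1)%N &
        Q = [set x | B [ffun i => sc_holds (a i) x]]].

End Semialgebraic.

Section ElekesSzabo.
Context {R : realType}.

Definition analytic_on (U : set R) (f : R -> R) : Prop :=
  forall x0, U x0 -> exists (a : nat -> R) (r : R), 0 < r /\
    forall x, `|x - x0| < r -> pseries a (x - x0) @ \oo --> f x.

Definition power_saving (s : nat) (c eta0 : R) (Q : set 'rV[R]_s) : Prop :=
  forall (n : nat) (A : 'I_s -> {fset R}), (forall i, #|` A i|%fset = n) ->
    (grid_count Q A)%:R <= c * n%:R `^ (s%:R - 1 - eta0).

Definition additive_form (s : nat) (Q : set 'rV[R]_s) : Prop :=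
  exists (U : 'I_s -> set R) (W : set R) (phi psi : 'I_s -> R -> R),
    [/\ forall i, open (U i) /\ U i !=set0,
        open W /\ W 0,
        forall i, [/\ set_bij (U i) W (phi i),
                      forall u, U i u -> psi i (phi i u) = u,
                      analytic_on (U i) (phi i) &
                      analytic_on W (psi i)] &
        forall x : 'rV[R]_s, (forall i, U i (x 0 i)) ->
          (Q x <-> \sum_(i < s) phi i (x 0 i) = 0)].

(* eta0 is an exponent for which the Chernikov-Peterzil-Starchenko dichotomy
   holds in R^s: it serves all D and Q at once, and the constant c depends
   only on s and D. *)
Definition Elekes_Szabo_exponent (s : nat) (eta0 : R) : Prop :=
  0 < eta0 /\
  forall D : nat, exists c : R, 0 < c /\
    forall Q : set 'rV[R]_s,
      description_complexity_le D Q -> finite_to_one_projections Q ->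
      (power_saving c eta0 Q /\ ~ additive_form Q) \/
      (~ power_saving c eta0 Q /\ additive_form Q).

End ElekesSzabo.

Section Smooth.
Context {R : realType} {n : nat}.

Fixpoint Ck_on (k : nat) (U : set 'rV[R]_n.+1) (f : 'rV[R]_n.+1 -> R) : Prop :=
  (forall x, U x -> {for x, continuous f}) /\
  match k with
  | 0 => True
  | k'.+1 => forall i : 'I_n.+1,
      (forall x, U x -> derivable f x (delta_mx 0 i)) /\
      Ck_on k' U (fun x => 'D_(delta_mx 0 i) f x)
  end.

Definition smooth_on (U : set 'rV[R]_n.+1) (f : 'rV[R]_n.+1 -> R) : Prop :=
  forall k, Ck_on k U f.

(* Embedded hypersurface of class C^oo in R^(n+1). *)
Definition smooth_hypersurface (Q : set 'rV[R]_n.+1) : Prop :=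
  forall p, Q p -> exists (U : set 'rV[R]_n.+1) (f : 'rV[R]_n.+1 -> R),
    [/\ open U /\ U p,
        smooth_on U f,
        exists i : 'I_n.+1, 'D_(delta_mx 0 i) f p != 0 &
        Q `&` U = [set x | U x /\ f x = 0]].

End Smooth.

Record sphere_family (R : realType) (d : nat) := SphereFamily {
  param : set R;
  centre_poly : 'I_d -> {poly R};
  radius_poly : {poly R};
  param_open : open param;
  param_interval : is_interval param;
  radius_gt0 : forall t, param t -> 0 < radius_poly.[t]
}.

Section SphereFamilies.
Context {R : realType} {d : nat}.
Implicit Type P : sphere_family R d.

Definition centre P (t : R) : 'rV[R]_d := \row_(i < d) (centre_poly P i).[t].

Definition sphere P (t : R) : set 'rV[R]_d :=
  [set x | \sum_(i < d) (x 0 i - centre P t 0 i) ^+ 2 = (radius_poly P).[t] ^+ 2].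

(* R^d x R is 'rV[R]_d.+1, with t as the last coordinate. *)
Definition incidence_hypersurface P : set 'rV[R]_d.+1 :=
  [set z : 'rV[R]_d.+1 | param P (z 0 ord_max) /\ sphere P (z 0 ord_max) (col' ord_max z)].

Definition regular_family P : Prop :=
  smooth_hypersurface (incidence_hypersurface P) /\
  finite_to_one_projections (incidence_hypersurface P).

(* The factors A_1, ..., A_d, T0 of the grid A_1 x ... x A_d x T0. *)
Definition grid_factors (A : 'I_d -> {fset R}) (T0 : {fset R}) :
    'I_d.+1 -> {fset R} :=
  fun k => if unlift ord_max k is Some i then A i else T0.

Definition concentric P : Prop :=
  forall t u, param P t -> param P u -> centre P t = centre P u.

Definition fixed_radius P : Prop :=
  forall t u, param P t -> param P u -> (radius_poly P).[t] = (radius_poly P).[u].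

Definition centres_on_axis_parallel_line P : Prop :=
  exists (p : 'rV[R]_d) (i : 'I_d), forall t, param P t ->
    exists l : R, centre P t = p + l *: delta_mx 0 i.

End SphereFamilies.

(* Main.v *)
Require Import Defs.
From mathcomp Require Import all_boot all_order all_algebra.
From mathcomp Require Import finmap.
From mathcomp Require Import all_classical all_reals all_analysis.
From mathcomp Require Import -(notations) mpoly.
From mathcomp Require Import ring lra zify.

Import Order.TTheory GRing.Theory Num.Theory.
Import numFieldNormedType.Exports.

Local Open Scope classical_set_scope.
Local Open Scope ring_scope.

(** The incidence hypersurface Q is semialgebraic
    ([incidence_hypersurface_semialgebraic]), so the Elekes-Szabo dichotomy applies to it.
    A power saving n ^ (d - eta0) is incompatible with n ^ (d - eta0 / 2) incidences on
    arbitrarily large grids ([power_saving_not_rich]). Hence near some point Q is the set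
    where analytic coordinates x_i = chi_i(w_i), t = tau(s) satisfy s = w_1 + ... + w_d
    ([additive_form_chart]), and it remains to see how rarely a family of spheres
    has such a form. Since the centres and radii are polynomials in t, it is enough to
    determine them on the infinite set of values of tau.

    If d >= 3, fix s and let two coordinates vary with constant sum, a third one and all the
    others being fixed: (x - a(t)) ^ 2 + (y - b(t)) ^ 2 then depends only on the sum of the
    parameters of x and y, for every t = tau(s). Comparing this for two values of t on a few
    points in arithmetic progression gives the same centre
    ([three_summands_centre], [chart_concentric]).

    If d = 2, write a, b, rho for the coordinates of the centre and the radius. With y fixed,
    differentiation in the parameter u of x = f(u) gives
    (x - a) f'(u) = tau'(s) ((x - a) a' + (y - b) b' + rho rho'),
    where y - b is a square root of rho ^ 2 - (x - a) ^ 2. Here f'(u) depends on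
    x alone. Where b' does not vanish, f' thus determines the branch points a +- rho of the
    square root, so a and rho are the same for all such t ([circle_pair_rigid],
    [circle_family_moving_centre]). Thus if one coordinate of the centre moves,
    the other one and the radius are constant; if none moves, the circles are concentric. *)

(** * Polynomials and infinite sets *)

Lemma poly_eq0_infinite_roots (R : idomainType) (X : set R) (p : {poly R}) :
  infinite_set X -> (forall x, X x -> p.[x] = 0) -> p = 0.
Proof.
move=> Xinf pX0; apply/eqP/negPn/negP => p0.
have [B BX] := infinite_set_fset (size p) Xinf.
rewrite leqNgt => /negP; apply.
apply: max_poly_roots => //; last exact: fset_uniq.
by apply/allP => x xB; apply/eqP/pX0/BX.
Qed.

Lemma infinite_image_interval (R : realType) (e : R) (f : R -> R) :
  0 < e -> {in [pred u | `|u| < e] &, injective f} ->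
  infinite_set (f @` [set u | `|u| < e]).
Proof.
move=> e0 finj; pose g (n : nat) := e / n.+2%:R.
have gV n : `|g n| < e.
  rewrite ger0_norm ?divr_ge0 ?ltW//.
  by rewrite ltr_pdivrMr// ltr_pMr// ltr1n.
apply: (@sub_infinite_set _ ((f \o g) @` [set: nat])).
  by move=> _ [n _ <-]; exists (g n) => //=; exact: gV.
move=> fin; apply: infinite_nat.
rewrite -(eq_finite_set (@inj_card_eq _ _ _ (f \o g) _)) //.
move=> m n _ _ /finj; rewrite !inE => /(_ (gV m) (gV n)).
move=> /mulfI; rewrite gt_eqF// => /(_ isT) /invr_inj /eqP.
by rewrite eqr_nat => /eqP[].
Qed.

Lemma deriv_eq0_const (R : numDomainType) (p : {poly R}) :
  p^`() = 0 -> p = (p`_0)%:P.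
Proof.
move=> p'0; apply/polyP => -[|i]; rewrite coefC//=.
have := congr1 (fun q : {poly R} => q`_i) p'0.
by rewrite /= coef_deriv coef0 => /eqP; rewrite mulrn_eq0 => /eqP.
Qed.

(** * Differentiability of analytic functions *)

Lemma geometric_sum_le (R : realType) (c : nat -> R) (M : R) (N : nat) :
  (forall n, `|c n| <= M * (2^-1) ^+ n) -> `|\sum_(0 <= n < N) c n| <= 2 * M.
Proof.
move=> cM.
have : `|\sum_(0 <= n < N) c n| <= 2 * M - 2 * M * (2^-1) ^+ N.
  elim: N => [|N IH]; first by rewrite big_nil normr0 expr0 mulr1 subrr.
  rewrite big_nat_recr//= (le_trans (ler_normD _ _))//.
  rewrite (le_trans (lerD IH (cM N)))// exprS.
  by set q := 2^-1 ^+ N; lra.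
have M0 : 0 <= M by have := le_trans (normr_ge0 _) (cM 0%N); rewrite expr0 mulr1.
move=> /le_trans; apply; rewrite lerBlDr lerDl.
by rewrite !mulr_ge0// exprn_ge0// invr_ge0.
Qed.

(** Only differentiability at the centre is needed, since [analytic_on] provides a power
    series around every point of its domain. *)
Lemma is_derive_pseries_center (R : realType) (a : nat -> R) (f : R -> R) (x0 r : R) :
  0 < r -> (forall x, `|x - x0| < r -> pseries a (x - x0) @ \oo --> f x) ->
  is_derive x0 1 f (a 1%N).
Proof.
move=> r0 af.
have [K K0 rK] : exists2 K, 0 < K & r = 2 * K.
  by exists (r / 2); [rewrite divr_gt0|rewrite mulrC divfK].
have [B B0 aB] : exists2 B, 0 <= B & forall n, `|a n * K ^+ n| <= B.
  have /cvg_series_bounded/pinfty_ex_gt0[B B0 HB] : cvgn (pseries a K).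
    apply/cvg_ex; exists (f (x0 + K)).
    have := af (x0 + K); rewrite [x0 + K - x0]addrC addKr; apply.
    by rewrite gtr0_norm//; lra.
  by exists B; [exact: ltW|move=> n; exact: HB].
pose C := 2 * (B / K ^+ 2).
have fE : f x0 = a 0%N.
  have := af x0; rewrite subrr normr0 => /(_ r0) H.
  apply: (cvg_unique _ H) => //=.
  apply: cvg_near_cst; near=> n; rewrite /pseries /series/=.
  have -> : n = n.-1.+1 by rewrite prednK//; near: n; exact: nbhs_infty_gt.
  rewrite big_nat_recl//= expr0 mulr1 big1 ?addr0// => i _.
  by rewrite exprS mul0r mulr0.
(* For h at most K / 2 the tail of the series is dominated by a geometric series. *)
have taylor h : `|h| < K / 2 -> `|f (x0 + h) - a 0%N - a 1%N * h| <= C * `|h| ^+ 2.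
  move=> hK.
  have cf : pseries a h @ \oo --> f (x0 + h).
    have := af (x0 + h); rewrite [x0 + h - x0]addrC addKr; apply.
    by rewrite (lt_trans hK)//; lra.
  have : `|pseries a h (N + 2)%N - a 0%N - a 1%N * h| @[N --> \oo]
      --> `|f (x0 + h) - a 0%N - a 1%N * h|.
    apply: cvg_norm; apply: cvgB; last exact: cvg_cst.
    apply: cvgB; last exact: cvg_cst.
    by rewrite (cvg_shiftn 2 (pseries a h)).
  move=> cv; rewrite -(cvg_lim _ cv)//.
  apply: limr_le; first by apply: cvgP cv.
  near=> N; rewrite addn2 /pseries /series/= !big_nat_recl//= expr0 mulr1 expr1.
  rewrite (_ : forall x y z : R, x + (y + z) - x - y = z); last by move=> *; ring.
  rewrite /C -mulrA; apply: geometric_sum_le => n.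
  have -> : a n.+2 * h ^+ n.+2 = a n.+2 * K ^+ n.+2 * (h / K) ^+ n.+2.
    by rewrite expr_div_n -[RHS]mulrA; congr (_ * _); rewrite mulrC divfK// expf_neq0// gt_eqF.
  rewrite normrM normrX [ `|h / K| ]normrM normfV (gtr0_norm K0).
  rewrite -[n.+2 in X in _ * X]/(2 + n)%N exprD (mulrA `|_|).
  have q0 : 0 <= `|h| / K by rewrite divr_ge0// ltW.
  apply: ler_pM; rewrite ?exprn_ge0//.
  - by rewrite mulr_ge0// sqr_ge0.
  - rewrite expr_div_n [leRHS]mulrAC -[leRHS]mulrA ler_wpM2r//.
    by rewrite divr_ge0// sqr_ge0.
  - rewrite lerXn2r ?nnegrE ?invr_ge0//.
    by rewrite ler_pdivrMr// mulrC ltW.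
have lim1 : (fun h => h^-1 *: ((f \o shift x0) (h *: 1) - f x0)) @ 0^' --> a 1%N.
  apply/cvgrPdist_le => e e0.
  near=> h.
  have h0 : h != 0 by near: h; exact: nbhs_dnbhs_neq.
  have hK : `|h| < K / 2.
    near: h; apply: dnbhs0_lt; by rewrite divr_gt0.
  have hC : `|h| <= e / (C + 1).
    near: h; apply: dnbhs0_le; rewrite divr_gt0// ltr_wpDl//.
    by rewrite /C !mulr_ge0 ?invr_ge0 ?exprn_ge0// ltW.
  have quotE (y z : R) : h^-1 * y - z = h^-1 * (y - z * h) by field.
  rewrite distrC; have T := taylor h hK.
  rewrite /= [h *: 1]mulr1 [h + x0]addrC fE.
  rewrite [X in `|X| <= _](_ : _ = h^-1 * (f (x0 + h) - a 0%N - a 1%N * h)).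
    2: exact: quotE.
  rewrite normrM normfV.
  rewrite mulrC ler_pdivrMr ?normr_gt0//.
  apply: (le_trans T).
  have C0 : 0 <= C by rewrite /C !mulr_ge0 ?invr_ge0 ?exprn_ge0// ltW.
  rewrite expr2 mulrA ler_wpM2r//.
  have C1 : 0 < C + 1 by rewrite ltr_wpDl.
  move: hC; rewrite ler_pdivlMr// => hC.
  by apply: le_trans hC; have := normr_ge0 h; lra.
split; first by apply: cvgP lim1.
exact: cvg_lim lim1.
Unshelve. all: by end_near.
Qed.

Lemma analytic_on_is_derive (R : realType) (U : set R) (f : R -> R) (x : R) :
  analytic_on U f -> U x -> exists df : R, is_derive x 1 f df.
Proof.
move=> fan /fan[a [r [r0 af]]]; exists (a 1%N).
exact: is_derive_pseries_center r0 af.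
Qed.

(** * Rigidity of circles *)

(** Think of [y1] and [y2] as the two-valued functions sqrt (r_i ^ 2 - (x - a_i) ^ 2) of [x].
    The last hypothesis says that the field they generate over the rational functions of [x]
    is the same, so they must branch at the same points a_i +- r_i. *)
Lemma circle_pair_rigid (R : realFieldType) (X : set R) (N1 N2 : {poly R})
    (a1 a2 r1 r2 k1 k2 : R) :
  infinite_set X -> r1 != 0 -> k1 != 0 -> k2 != 0 ->
  (forall x, X x -> exists y1 y2,
    [/\ (x - a1) ^+ 2 + y1 ^+ 2 = r1 ^+ 2,
        (x - a2) ^+ 2 + y2 ^+ 2 = r2 ^+ 2 &
        (x - a2) * (N1.[x] + k1 * y1) = (x - a1) * (N2.[x] + k2 * y2)]) ->
  a1 = a2 /\ r1 ^+ 2 = r2 ^+ 2.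
Proof.
move=> Xinf r10 k10 k20 HX.
pose S1 : {poly R} := - ('X - a1%:P) ^+ 2 + (r1 ^+ 2)%:P.
pose S2 : {poly R} := - ('X - a2%:P) ^+ 2 + (r2 ^+ 2)%:P.
pose L1 : {poly R} := k1 *: ('X - a2%:P).
pose L2 : {poly R} := k2 *: ('X - a1%:P).
pose M : {poly R} := ('X - a2%:P) * N1 - ('X - a1%:P) * N2.
have lcS1 : lead_coef S1 = -1.
  rewrite lead_coefDl ?lead_coefN ?lead_coef_exp ?lead_coefXsubC ?expr1n//.
  by rewrite size_polyN size_exp_XsubC (leq_ltn_trans (size_polyC_leq1 _)).
have lcL1 : lead_coef L1 = k1 by rewrite lead_coefZ lead_coefXsubC mulr1.
(* On X the last hypothesis reads M + (x - a2) k1 y1 = (x - a1) k2 y2. Squaring it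
   and using y_i ^ 2 = S_i leaves a single term linear in y1; isolating that term
   and squaring again gives a polynomial identity. *)
have key : (L2 ^+ 2 * S2 - L1 ^+ 2 * S1 - M ^+ 2) ^+ 2 = 4%:P * M ^+ 2 * L1 ^+ 2 * S1.
  apply/eqP; rewrite -subr_eq0; apply/eqP.
  apply: poly_eq0_infinite_roots Xinf _ => x /HX[y1 [y2 [e1 e2 e12]]].
  rewrite /L1 /L2 /S1 /S2 /M !hornerE /=.
  have -> : - (x - a1) ^+ 2 + r1 ^+ 2 = y1 ^+ 2 by rewrite -e1; ring.
  have -> : - (x - a2) ^+ 2 + r2 ^+ 2 = y2 ^+ 2 by rewrite -e2; ring.
  have e3 : k2 * (x - a1) * y2 =
      (x - a2) * N1.[x] - (x - a1) * N2.[x] + k1 * (x - a2) * y1.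
    transitivity ((x - a1) * (N2.[x] + k2 * y2) - (x - a1) * N2.[x]); first by ring.
    by rewrite -e12; ring.
  rewrite -[X in (X - _ - _) ^+ 2]exprMn e3; ring.
(* Otherwise the square on the left would have a negative leading coefficient, that
   of S1 times squares. *)
have M0 : M = 0.
  apply/eqP/negPn/negP => M0.
  have := congr1 (@lead_coef R) key.
  rewrite !expr2 !lead_coefM lcS1 lcL1 lead_coefC.
  set c := lead_coef _; set m := lead_coef _ => E.
  have m0 : m != 0 by rewrite lead_coef_eq0.
  have : 0 < (2 * m * k1) ^+ 2 by rewrite exprn_even_gt0//= !mulf_neq0// pnatr_eq0.
  by have := sqr_ge0 c; rewrite expr2 E; lra.
have key2 : L2 ^+ 2 * S2 = L1 ^+ 2 * S1.
  move: key; rewrite M0 !expr2 !(mulr0, mul0r, subr0) => /eqP.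
  by rewrite mulf_eq0 orbb subr_eq0 => /eqP.
have a12 : a1 = a2.
  move/(congr1 (horner^~ a1)): key2; rewrite /L1 /L2 /S1 /S2 !hornerE /=.
  rewrite subrr !mulr0 expr0n/= mul0r oppr0 add0r => /esym/eqP.
  by rewrite mulf_eq0 !expf_eq0/= mulf_eq0 (negPf k10) (negPf r10) orbF subr_eq0 => /eqP.
split=> //.
(* a1 + r1 is a root of S1, hence of S2. *)
move/(congr1 (horner^~ (a1 + r1))): key2; rewrite /L1 /L2 /S1 /S2 !hornerE /= -a12.
rewrite [a1 + r1]addrC addrK addNr mulr0 => /eqP.
rewrite mulf_eq0 expf_eq0/= mulf_eq0 (negPf k20) (negPf r10)/=.
by rewrite addrC subr_eq0 => /eqP ->.
Qed.

(** The hypothesis says that both circles, read in the coordinates [f] and [g], depend only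
    on the sum of the arguments. Were [a] and [a'] different, subtracting the equations would
    make [f] and [g] affine along arithmetic progressions, and an affine parametrization
    cannot turn a sum of two squares into a function of a sum. *)
Lemma three_summands_centre (R : realFieldType) (e : R) (f g : R -> R) (a b a' b' : R) :
  0 < e ->
  {in [pred u | `|u| < e] &, injective f} -> {in [pred u | `|u| < e] &, injective g} ->
  (forall x y x' y', `|x| < e -> `|y| < e -> `|x'| < e -> `|y'| < e ->
     x + y = x' + y' ->
     (f x - a) ^+ 2 + (g y - b) ^+ 2 = (f x' - a) ^+ 2 + (g y' - b) ^+ 2 /\
     (f x - a') ^+ 2 + (g y - b') ^+ 2 = (f x' - a') ^+ 2 + (g y' - b') ^+ 2) ->
  a = a'.
Proof.
move=> e0 finj ginj H; pose h := e / 3.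
have h0 : `|0 : R| < e by rewrite normr0.
have hh : `|h| < e by rewrite gtr0_norm /h; lra.
have h2 : `|h + h| < e by rewrite gtr0_norm /h; lra.
have hn0 : h != 0 by rewrite /h; lra.
have fn : f h != f 0.
  by apply: contraNneq hn0 => /finj ->//; rewrite inE.
have gn : g (h + h) != g 0.
  apply: contraNneq hn0 => /ginj; rewrite !inE => /(_ h2 h0) ?; lra.
have e1 : h + 0 = 0 + h by rewrite addrC.
have e2 : h + h = 0 + (h + h) by rewrite add0r.
have [A1 A2] := H _ _ _ _ hh h0 h0 hh e1.
have [B1 B2] := H _ _ _ _ hh hh h0 h2 e2.
apply/eqP/negPn/negP => aa'.
set x := f h in fn A1 A2 B1 B2; set x' := f 0 in fn A1 A2 B1 B2.
set y0 := g 0 in gn A1 A2 B1 B2; set y1 := g h in gn A1 A2 B1 B2.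
set y2 := g (h + h) in gn B1 B2.
have x0 : x - x' != 0 by rewrite subr_eq0.
have d0 : a - a' != 0 by rewrite subr_eq0.
(* Subtracting the two circle equations leaves a linear relation, so g 0, g h and
   g (h + h) are in arithmetic progression, with a nonzero step. *)
have C1 : (a - a') * (x - x') = (b - b') * (y1 - y0) by lra.
have C2 : (a - a') * (x - x') = (b - b') * (y2 - y1) by lra.
have N0 : (b - b') * (y1 - y0) != 0 by rewrite -C1 mulf_neq0.
have [b0 q0] : b - b' != 0 /\ y1 - y0 != 0 by apply/andP; rewrite -negb_or -mulf_eq0.
have step : y2 - y1 = y1 - y0 by apply: (mulfI b0); rewrite -C1 -C2.
(* Two consecutive steps of g compensate the same change in f, so the first circle
   equation forces the quadratic (y - b) ^+ 2 to grow equally along both. *)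
have : (y1 - y0) * (y2 - y0) = 0.
  have : (y1 - y0) * (y1 + y0 - 2 * b) = (y2 - y1) * (y2 + y1 - 2 * b) by lra.
  rewrite step => /(mulfI q0); lra.
by move/eqP; rewrite mulf_eq0 (negPf q0) subr_eq0 (negPf gn).
Qed.

(** * Regular coordinates and moving circles *)

(** The inverses of the maps of an additive form, near 0, are coordinates of this kind. *)
Definition regular_coordinate (R : realType) (e : R) (f : R -> R) : Prop :=
  {in [pred u | `|u| < e] &, injective f} /\
  forall u : R, `|u| < e -> exists2 df : R, is_derive u 1 f df & df != 0.

(** The derivative of [psi] cannot vanish because [phi] is differentiable too and
    [phi \o psi] is the identity near every point. *)
Lemma analytic_inverse_regular_coordinate (R : realType) (e : R) (U W : set R)
    (phi psi : R -> R) :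
  open W -> (forall w, `|w| < e -> W w) ->
  set_bij U W phi -> (forall u, U u -> psi (phi u) = u) ->
  analytic_on U phi -> analytic_on W psi ->
  regular_coordinate R e psi.
Proof.
move=> Wopen eW [_ _ phisurj] psiK phian psian.
have psiP w : W w -> U (psi w) /\ phi (psi w) = w.
  by move=> /phisurj[u Uu <-]; rewrite psiK.
split=> [v w|w].
  rewrite !inE => /eW/psiP[_ phiv] /eW/psiP[_ phiw] vw.
  by rewrite -phiv vw phiw.
move=> /eW Ww; have [Upsi _] := psiP w Ww.
have [dpsi psiD] := analytic_on_is_derive _ _ _ _ psian Ww.
have [dphi phiD] := analytic_on_is_derive _ _ _ _ phian Upsi.
exists dpsi => //; apply/eqP => dpsi0.
have : 'D_1 (phi \o psi) w = 'D_1 (id : R -> R) w.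
  apply: near_eq_derive; apply: filterS (open_nbhs_nbhs (conj Wopen Ww)) => z Wz.
  by have [_] := psiP z Wz.
rewrite (@derive_val _ _ _ _ _ _ _ (is_derive1_comp phiD psiD)) derive_id dpsi0 mulr0.
by move/esym/eqP; rewrite oner_eq0.
Qed.

Lemma regular_coordinate_opp (R : realType) (e : R) (f : R -> R) :
  regular_coordinate R e f -> regular_coordinate R e (fun s => f (- s)).
Proof.
move=> [finj fD]; split=> [u v|u ue].
  by rewrite !inE => ue ve /finj; rewrite !inE !normrN => /(_ ue ve)/oppr_inj.
have [|df fDu df0] := fD (- u); first by rewrite normrN.
exists (- df); last by rewrite oppr_eq0.
rewrite -[- df]mulrN1.
exact: (is_derive1_comp (g := -%R) fDu (is_deriveNid u 1)).
Qed.

(** Differentiating the equation of the moving circle along a curve on which the ordinate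
    [y] stays fixed: the parameter of the circle has to move to compensate the abscissa. *)
Lemma circle_chart_derivative (R : realType) (f tau : R -> R) (a b rho : {poly R})
    (u v y df dtau e : R) :
  is_derive u 1 f df -> is_derive (u + v) 1 tau dtau ->
  0 < e ->
  (forall u', `|u' - u| < e ->
     (f u' - a.[tau (u' + v)]) ^+ 2 + (y - b.[tau (u' + v)]) ^+ 2
       = rho.[tau (u' + v)] ^+ 2) ->
  let t := tau (u + v) in
  (f u - a.[t]) * df =
    dtau * ((f u - a.[t]) * a^`().[t] + (y - b.[t]) * b^`().[t]
            + rho.[t] * rho^`().[t]).
Proof.
move=> fD tauD e0 H t.
have tsD : is_derive u 1 (tau \o shift v) dtau.
  rewrite -[dtau]mulr1.
  exact: (is_derive1_comp (g := shift v) tauD (is_derive_shift u 1 v)).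
have pD (p : {poly R}) : is_derive u 1 (horner p \o (tau \o shift v)) (p^`().[t] * dtau).
  exact: (is_derive1_comp (g := tau \o shift v) (is_derive_poly p _) tsD).
pose F := (f - (horner a \o (tau \o shift v))) ^+ 2 +
          (cst y - (horner b \o (tau \o shift v))) ^+ 2 -
          (horner rho \o (tau \o shift v)) ^+ 2.
have FD := is_deriveB (is_deriveD (is_deriveX 2 (is_deriveB fD (pD a)))
  (is_deriveX 2 (is_deriveB (is_derive_cst y u 1) (pD b)))) (is_deriveX 2 (pD rho)).
have F0 : 'D_1 F u = 0.
  rewrite (_ : 0 = 'D_1 (cst 0 : R -> R) u); last by rewrite derive_cst.
  apply: near_eq_derive; apply: filterS (nbhsx_ballx u e e0) => z.
  rewrite /ball/= distrC => /H Hz.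
  by rewrite /F/= -[LHS]/((f z - a.[tau (z + v)]) ^+ 2
    + (y - b.[tau (z + v)]) ^+ 2 - rho.[tau (z + v)] ^+ 2) Hz subrr.
move: F0; rewrite (@derive_val _ _ _ _ _ _ _ FD) /=.
rewrite -[(_ - _) u]/(f u - a.[t]) -[(_ - _) u]/(y - b.[t]) -/t.
have E (p q r x z w d k : R) : (2 * p ^+ 1) * (d - x * k) + (2 * q ^+ 1) * (0 - z * k)
    - (2 * r ^+ 1) * (w * k) = 0 -> p * d = k * (p * x + q * z + r * w).
  by rewrite !expr1; lra.
exact: E.
Qed.

(** As soon as two circles of the family have their centres moving in the second direction,
    [circle_pair_rigid] applies to them: comparing [circle_chart_derivative] for
    the two of them eliminates the derivative of [f], and the coefficients of the square
    roots are the nonzero numbers dtau * b'(t). Polynomiality propagates the resulting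
    equality of first coordinates and radii to the whole family. *)
Lemma circle_family_moving_centre (R : realType) (e : R) (f g tau : R -> R)
    (a b rho : {poly R}) :
  0 < e -> regular_coordinate R e f -> regular_coordinate R e tau ->
  (forall u v, `|u| < e -> `|u + v| < e ->
     (f u - a.[tau (u + v)]) ^+ 2 + (g v - b.[tau (u + v)]) ^+ 2
       = rho.[tau (u + v)] ^+ 2) ->
  (forall s, `|s| < e -> rho.[tau s] != 0) ->
  b^`() != 0 ->
  exists c r, a = c%:P /\ rho ^+ 2 = r%:P.
Proof.
move=> e0 [finj fD] [tauinj tauD] H rho0 b0.
have tauinf := infinite_image_interval R e tau e0 tauinj.
have rigid s1 s2 : `|s1| < e -> `|s2| < e -> b^`().[tau s1] != 0 -> b^`().[tau s2] != 0 ->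
    a.[tau s1] = a.[tau s2] /\ rho.[tau s1] ^+ 2 = rho.[tau s2] ^+ 2.
  move=> s1e s2e b1 b2.
  have [k1 tauD1 k10] := tauD _ s1e; have [k2 tauD2 k20] := tauD _ s2e.
  pose N k t : {poly R} :=
    k *: (('X - (a.[t])%:P) * (a^`().[t])%:P + (rho.[t] * rho^`().[t])%:P).
  apply: (circle_pair_rigid R _ (N k1 (tau s1)) (N k2 (tau s2)) _ _ _ _
    (k1 * b^`().[tau s1]) (k2 * b^`().[tau s2])
    (infinite_image_interval R e f e0 finj)); rewrite ?mulf_neq0 ?rho0//.
  move=> _ [u /= ue <-].
  exists (g (s1 - u) - b.[tau s1]), (g (s2 - u) - b.[tau s2]).
  have usE s : u + (s - u) = s by rewrite addrC subrK.
  have circ s : `|s| < e -> (f u - a.[tau s]) ^+ 2 + (g (s - u) - b.[tau s]) ^+ 2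
      = rho.[tau s] ^+ 2.
    by move=> se; have := H u (s - u); rewrite usE; exact.
  split; [exact: circ|exact: circ|].
  (* The derivative of f at u does not depend on s: it can be eliminated between
     the relations at s1 and s2. *)
  have [df fDu _] := fD _ ue.
  have slope s k : `|s| < e -> is_derive s (1 : R) tau k -> (f u - a.[tau s]) * df =
     (N k (tau s)).[f u] + k * b^`().[tau s] * (g (s - u) - b.[tau s]).
    move=> se tauDs.
    have tauDs' : is_derive (u + (s - u)) (1 : R) tau k by rewrite usE.
    have := circle_chart_derivative R f tau a b rho u (s - u) (g (s - u)) df k
      (Num.min (e - `|u|) (e - `|s|)) fDu tauDs'.
    rewrite lt_min !subr_gt0 ue se usE => /(_ isT) E.
    rewrite E; first by rewrite /N !hornerE /=; ring.
    move=> u'; rewrite lt_min => /andP[u'1 u'2]; apply: H.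
      by have := ler_normD (u' - u) u; rewrite subrK; lra.
    have := ler_normD (u' - u) s.
    by rewrite -addrA [- u + s]addrC; lra.
  by rewrite -!slope//; ring.
have [s1 s1e b1] : exists2 s1, `|s1| < e & b^`().[tau s1] != 0.
  apply: contrapT => nex; move/eqP: b0; apply.
  apply: poly_eq0_infinite_roots tauinf _ => _ [s /= se <-].
  by apply/eqP/negPn/negP => bs; apply: nex; exists s.
(* The factor b^`() removes the finitely many t at which rigid says nothing. *)
have const (q : {poly R}) : (forall s, `|s| < e -> b^`().[tau s] != 0 ->
    q.[tau s] = q.[tau s1]) -> q = (q.[tau s1])%:P.
  move=> qc; apply/eqP; rewrite -subr_eq0.
  have : b^`() * (q - (q.[tau s1])%:P) = 0.
    apply: poly_eq0_infinite_roots tauinf _ => _ [s /= se <-].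
    rewrite !hornerE; have [->|bs] := eqVneq b^`().[tau s] 0; first by rewrite mul0r.
    by rewrite qc// subrr mulr0.
  by move/eqP; rewrite mulf_eq0 (negPf b0).
exists a.[tau s1], (rho ^+ 2).[tau s1]; split; apply: const => s se bs.
  by have [] := rigid s s1 se s1e bs b1.
by rewrite !horner_exp; have [] := rigid s s1 se s1e bs b1.
Qed.

(** * The incidence hypersurface in additive coordinates *)

(** Reading the additive form backwards: in the coordinates [chi] and [tau] the incidence
    relation becomes s = w_1 + ... + w_d. The sign of the last summand of the additive
    form is absorbed in [tau]. *)
Lemma additive_form_chart (R : realType) (d : nat) (P : sphere_family R d) :
  additive_form (incidence_hypersurface P) ->
  exists (e : R) (chi : 'I_d -> R -> R) (tau : R -> R),
    [/\ 0 < e, forall i, regular_coordinate R e (chi i), regular_coordinate R e tau &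
        forall w : 'I_d -> R, (forall i, `|w i| < e) -> `|\sum_i w i| < e ->
          param P (tau (\sum_i w i)) /\
          sphere P (tau (\sum_i w i)) (\row_i chi i (w i))].
Proof.
move=> [U [W [phi [psi [Uopen [Wopen W0] phipsi QE]]]]].
have /nbhs_ballP[e /= e0 eW] := open_nbhs_nbhs (conj Wopen W0).
have {}eW w : `|w| < e -> W w.
  by move=> we; apply: eW; rewrite /ball/= sub0r normrN.
have psireg k : regular_coordinate R e (psi k).
  have [phibij psiK phian psian] := phipsi k.
  exact: analytic_inverse_regular_coordinate Wopen eW phibij psiK phian psian.
have psiP k w : W w -> U k (psi k w) /\ phi k (psi k w) = w.
  have [[_ _ phisurj] psiK _ _] := phipsi k.
  by move=> /phisurj[u Uu <-]; rewrite psiK.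
exists e, (fun i => psi (lift ord_max i)), (fun s => psi ord_max (- s)).
split=> // [|w we se]; first exact: regular_coordinate_opp.
pose w' k := if unlift ord_max k is Some i then w i else - \sum_i w i.
have w'W k : W (w' k).
  by rewrite /w'; case: unliftP => [i|] _; apply: eW; rewrite ?normrN.
pose x : 'rV[R]_d.+1 := \row_k psi k (w' k).
have : incidence_hypersurface P x.
  apply/QE; first by move=> k; rewrite mxE; have [] := psiP k _ (w'W k).
  under eq_bigr => k _ do rewrite mxE (psiP k _ (w'W k)).2.
  rewrite big_ord_recr/= /w' unlift_none.
  under eq_bigr => i _.
    rewrite (_ : widen_ord _ i = lift ord_max i) ?liftK; last first.
      by apply: val_inj; rewrite /= /bump leqNgt ltn_ord.
    over.
  by rewrite subrr.
rewrite /incidence_hypersurface /= [x 0 ord_max]mxE /w' unlift_none.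
rewrite (_ : col' ord_max x = \row_i psi (lift ord_max i) (w i))//.
by apply/rowP => i; rewrite !mxE /w' liftK.
Qed.

(** * Description complexity of the incidence hypersurface *)

(** A missing endpoint is encoded by the constant polynomial 1; the empty interval needs no
    case of its own, as it is bounded and its infimum and supremum agree by convention. *)
Lemma open_interval_polynomial_inequalities (R : realType) (I : set R) :
  open I -> is_interval I ->
  exists l r : {poly R}, forall t, I t <-> 0 < l.[t] /\ 0 < r.[t].
Proof.
move=> /interior_id Iopen Iint.
have [hl|hl] := pselect (has_lbound I); have [hr|hr] := pselect (has_ubound I).
- exists ('X - (inf I)%:P), ((sup I)%:P - 'X) => t.
  rewrite -{1}Iopen interval_bounded_interior//= !hornerE !subr_gt0.
  by split=> [/andP|[-> ->]].
- exists ('X - (inf I)%:P), 1 => t.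
  by rewrite -{1}Iopen interval_right_unbounded_interior//= !hornerE subr_gt0; split=> [|[]].
- exists 1, ((sup I)%:P - 'X) => t.
  by rewrite -{1}Iopen interval_left_unbounded_interior//= !hornerE subr_gt0; split=> [|[]].
- exists 1, 1 => t.
  by rewrite (interval_unbounded_setT Iint hl hr) hornerE.
Qed.

Lemma univariate_polynomial_mpoly (R : comNzRingType) (n : nat) (k : 'I_n) (p : {poly R}) :
  exists q : mpoly n R, forall v : 'I_n -> R, meval v q = p.[v k].
Proof.
exists (\sum_(i < size p) p`_i *: (mpolyX R (mnm1 k)) ^+ i) => v.
rewrite raddf_sum horner_coef; apply: eq_bigr => i _.
by rewrite /= mevalZ rmorphXn/= mevalXU.
Qed.

(** The interval of parameters is cut out by two inequalities of degree at most 1, the spheres by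
    one equation. *)
Lemma incidence_hypersurface_semialgebraic (R : realType) (d : nat) (P : sphere_family R d) :
  exists D, description_complexity_le D (incidence_hypersurface P).
Proof.
have [l [r paramE]] := open_interval_polynomial_inequalities R _
  (@param_open _ _ P) (@param_interval _ _ P).
have [l' l'E] := univariate_polynomial_mpoly R d.+1 ord_max l.
have [r' r'E] := univariate_polynomial_mpoly R d.+1 ord_max r.
have [rho rhoE] := univariate_polynomial_mpoly R d.+1 ord_max (radius_poly P).
have /choice[c cE] := fun i => univariate_polynomial_mpoly R d.+1 ord_max (centre_poly P i).
pose q : mpoly d.+1 R :=
  \sum_(i < d) (mpolyX R (mnm1 (lift ord_max i)) - c i) ^+ 2 - rho ^+ 2.
pose a (i : 'I_3) : @sign_condition R d.+1 :=
  match val i with 0%N => PolyEq0 q | 1%N => PolyGt0 l' | _ => PolyGt0 r' end.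
pose M := (\max_(i < 3) mmeasure mdeg (sc_poly (a i)))%N.
exists (3 + M)%N, 3%N, a, (fun f => [forall i, f i]).
split; first by rewrite leq_addr.
  move=> i; apply: (@leq_trans M); last by rewrite -addSn leq_addl.
  exact: (@leq_bigmax _ (fun i => mmeasure mdeg (sc_poly (a i)))).
have qE (z : 'rV[R]_d.+1) : meval (fun i => z 0 i) q = 0 <->
    sphere P (z 0 ord_max) (col' ord_max z).
  rewrite /q mevalB rmorphXn/= rhoE raddf_sum /sphere/=.
  under eq_bigr => i _ do rewrite rmorphXn/= mevalB mevalXU cE.
  under [X in _ <-> X = _]eq_bigr => i _ do rewrite !mxE.
  by split=> [/eqP|->]; rewrite ?subrr// subr_eq0 => /eqP.
apply/seteqP; split=> z /=.
  move=> [/paramE[l0 r0] /qE q0]; apply/forallP => -[[|[|[|//]]] ?]; rewrite ffunE /=.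
  - by rewrite q0.
  - by rewrite l'E.
  - by rewrite r'E.
move=> /forallP az; split; last first.
  by apply/qE/eqP; have := az ord0; rewrite ffunE.
apply/paramE; rewrite -(l'E (fun i => z 0 i)) -(r'E (fun i => z 0 i)).
by split; [have := az (@Ordinal 3 1 isT)|have := az (@Ordinal 3 2 isT)]; rewrite ffunE.
Qed.

(** * Power saving against rich grids *)

(** The two bounds differ by a factor n ^ (eta0 / 2), which tends to infinity. *)
Lemma power_saving_not_rich (R : realType) (d : nat) (c C eta0 : R) (Q : set 'rV[R]_d.+1) :
  0 < c -> 0 < C -> 0 < eta0 -> power_saving c eta0 Q ->
  exists N : nat, forall n (A : 'I_d.+1 -> {fset R}), (N <= n)%N ->
    (forall i, #|` A i|%fset = n) ->
    (grid_count Q A)%:R < C * n%:R `^ (d%:R - eta0 / 2).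
Proof.
move=> c0 C0 eta00 Qps.
pose K := (c / C) `^ (2 / eta0); exists (Num.truncn K).+1 => n A Nn An.
apply: le_lt_trans (Qps n A An) _.
have n0 : 0 < n%:R :> R by rewrite ltr0n (leq_trans _ Nn).
have Kn : K < n%:R by rewrite (lt_le_trans (truncnS_gt K))// ler_nat.
have -> : d.+1%:R - 1 - eta0 = (d%:R - eta0 / 2) + - (eta0 / 2) :> R.
  by rewrite -natr1; field.
rewrite powRD; last by rewrite (gt_eqF n0) implybT.
rewrite mulrC -mulrA mulrC ltr_pM2r ?powR_gt0//.
rewrite mulrC powRN ltr_pdivrMr ?powR_gt0// mulrC -ltr_pdivrMr//.
have -> : c / C = K `^ (eta0 / 2).
  rewrite -powRrM (_ : 2 / eta0 * (eta0 / 2) = 1) ?powRr1 ?divr_ge0 ?ltW//.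
  by field; rewrite gt_eqF.
by apply: gt0_ltr_powR; rewrite ?nnegrE ?powR_ge0 ?divr_gt0 ?ltW.
Qed.

(** * Spheres in dimension at least three *)

Lemma sum_three_indices (R : nmodType) (d : nat) (i j k : 'I_d) (z x y v : R)
    (G : 'I_d -> R -> R) :
  j != i -> k != i -> k != j ->
  \sum_l G l (if l == i then x else if l == j then y else if l == k then v else z)
  = G i x + (G j y + (G k v + \sum_(l | [&& l != i, l != j & l != k]) G l z)).
Proof.
move=> ji ki kj.
rewrite (bigD1 i)//= eqxx (bigD1 j)//= (negPf ji) eqxx.
rewrite (bigD1 k) ?ki ?kj//= (negPf ki) (negPf kj) eqxx.
congr (_ + (_ + (_ + _))); rewrite (eq_bigl (fun l => [&& l != i, l != j & l != k])).
  by apply: eq_bigr => l /and3P[/negPf-> /negPf-> /negPf->].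
by move=> l; rewrite -andbA.
Qed.

Lemma concentric_of_constant_centres (R : realType) (d : nat) (P : sphere_family R d) :
  (forall i, exists c, centre_poly P i = c%:P) -> concentric P.
Proof.
move=> cst t u _ _; apply/rowP => i; rewrite !mxE.
by have [c ->] := cst i; rewrite !hornerC.
Qed.

(** With at least three space coordinates, two of them can be varied while a third one
    keeps the total sum, hence the sphere, fixed: [three_summands_centre] then compares the
    centres for two values of the parameter. *)
Lemma chart_concentric (R : realType) (d : nat) (P : sphere_family R d) (e : R)
    (chi : 'I_d -> R -> R) (tau : R -> R) :
  (3 <= d)%N -> 0 < e ->
  (forall i, regular_coordinate R e (chi i)) -> regular_coordinate R e tau ->
  (forall w : 'I_d -> R, (forall i, `|w i| < e) -> `|\sum_i w i| < e ->
     sphere P (tau (\sum_i w i)) (\row_i chi i (w i))) ->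
  concentric P.
Proof.
move=> d3 e0 chireg taureg chart; apply: concentric_of_constant_centres => i.
pose a := centre_poly P.
have [j ji] : exists j, j != i.
  have /card_gt0P[j] : (0 < #|[set~ i]%SET|)%N by rewrite cardsC1 card_ord; lia.
  by rewrite !inE => ji; exists j.
have [k [ki kj]] : exists k, k != i /\ k != j.
  have /card_gt0P[k] : (0 < #|(~: [set i; j])%SET|)%N.
    by have := cardsC [set i; j]%SET; rewrite cards2 card_ord; lia.
  by rewrite !inE negb_or => /andP[ki kj]; exists k.
pose e3 := e / 3; have e30 : 0 < e3 by rewrite /e3; lra.
have e3e (u : R) : `|u| < e3 -> `|u| < e by rewrite /e3; lra.
have sub f : regular_coordinate R e f -> {in [pred u | `|u| < e3] &, injective f}.
  by move=> [finj _] u v; rewrite !inE => /e3e ue /e3e ve /finj; apply.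
(* The k-th coordinate absorbs the difference between s and the sum of the two
   others, which is why d >= 3 is needed. *)
have transfer s x y x' y' : `|s| < e3 -> `|x| < e3 -> `|y| < e3 ->
    `|x'| < e3 -> `|y'| < e3 -> x + y = x' + y' ->
    (chi i x - (a i).[tau s]) ^+ 2 + (chi j y - (a j).[tau s]) ^+ 2 =
    (chi i x' - (a i).[tau s]) ^+ 2 + (chi j y' - (a j).[tau s]) ^+ 2.
  move=> se xe ye x'e y'e xy.
  pose G l u := (chi l u - (a l).[tau s]) ^+ 2.
  have eqn p q : `|p| < e3 -> `|q| < e3 -> G i p + (G j q + (G k (s - (p + q)) +
      \sum_(l | [&& l != i, l != j & l != k]) G l 0)) = (radius_poly P).[tau s] ^+ 2.
    move=> pe qe; rewrite -sum_three_indices//.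
    pose w (l : 'I_d) :=
      if l == i then p else if l == j then q else if l == k then s - (p + q) else 0.
    have ws : \sum_l w l = s.
      rewrite /w (sum_three_indices _ _ i j k 0 p q (s - (p + q)) (fun=> id))//.
      by rewrite big1// addr0 addrA addrC subrK.
    have we l : `|w l| < e.
      rewrite /w; case: ifP => _; first exact: e3e.
      case: ifP => _; first exact: e3e.
      case: ifP => _; last by rewrite normr0.
      have := ler_normB s (p + q); have := ler_normD p q.
      by move: pe qe se; rewrite /e3; lra.
    have := chart w we; rewrite ws => /(_ (e3e _ se)); rewrite /sphere/= => <-.
    by apply: eq_bigr => l _; rewrite !mxE.
  have := eqn x y xe ye; rewrite -(eqn x' y' x'e y'e) xy !addrA.
  by move=> /addIr/addIr.
exists (a i).[tau 0]; apply/eqP; rewrite -subr_eq0; apply/eqP.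
apply: poly_eq0_infinite_roots (infinite_image_interval R e3 tau e30 (sub _ taureg)) _.
move=> _ [s /= se <-]; rewrite !hornerE; apply/eqP; rewrite subr_eq0; apply/eqP.
apply: (three_summands_centre R e3 (chi i) (chi j) _ (a j).[tau s] _ (a j).[tau 0]) => //;
  [exact: sub|exact: sub|].
by move=> x y x' y' xe ye x'e y'e xy; split; apply: transfer; rewrite ?normr0.
Qed.

(** * Circles in the plane *)

(** The moving coordinate [j] of the centre forces the other one and the radius to be
    constant, by [circle_family_moving_centre]. *)
Lemma chart_planar (R : realType) (P : sphere_family R 2) (e : R)
    (chi : 'I_2 -> R -> R) (tau : R -> R) (i j : 'I_2) :
  j != i -> 0 < e ->
  (forall i, regular_coordinate R e (chi i)) -> regular_coordinate R e tau ->
  (forall w : 'I_2 -> R, (forall i, `|w i| < e) -> `|\sum_i w i| < e ->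
     param P (tau (\sum_i w i)) /\
     sphere P (tau (\sum_i w i)) (\row_i chi i (w i))) ->
  (centre_poly P j)^`() != 0 ->
  fixed_radius P /\ centres_on_axis_parallel_line P.
Proof.
move=> ji e0 chireg [tauinj tauD] chart b0.
have ij k : k = i \/ k = j.
  by move: ji; case: i => -[|[|//]] ?; case: j {b0} => -[|[|//]] ?; case: k => -[|[|//]] ? //=;
    rewrite -?val_eqE //= => _; [left|right|right|left]; exact: val_inj.
have sum2 (V : nmodType) (G : 'I_2 -> V) : \sum_k G k = G i + G j.
  rewrite (bigD1 i)//= (bigD1 j)//= big1 ?addr0// => k /andP[/eqP ki /eqP kj].
  by have [] := ij k.
pose e2 := e / 2; have e20 : 0 < e2 by rewrite /e2; lra.
have e2e (u : R) : `|u| < e2 -> `|u| < e by have := e0; rewrite /e2; lra.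
have reg2 f : regular_coordinate R e f -> regular_coordinate R e2 f.
  move=> [finj fD]; split=> [u v|u /e2e]; last exact: fD.
  by rewrite !inE => /e2e ue /e2e ve /finj; apply.
have point u v : `|u| < e2 -> `|u + v| < e2 -> param P (tau (u + v)) /\
    (chi i u - (centre_poly P i).[tau (u + v)]) ^+ 2
    + (chi j v - (centre_poly P j).[tau (u + v)]) ^+ 2
    = (radius_poly P).[tau (u + v)] ^+ 2.
  move=> ue uve; pose w (k : 'I_2) := if k == i then u else v.
  have ws : \sum_k w k = u + v by rewrite sum2 /w eqxx (negPf ji).
  have [||pP sP] := chart w.
  - move=> k; rewrite /w; case: ifP => _; first exact: e2e.
    have := ler_normB (u + v) u; rewrite [u + v]addrC addrK [v + u]addrC.
    by move: ue uve; rewrite /e2; lra.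
  - by rewrite ws; exact: e2e.
  rewrite -ws; split=> //; move: sP; rewrite /sphere/= => <-.
  by rewrite [RHS]sum2 !mxE /w eqxx (negPf ji).
have [c [r [ac rhor]]] : exists c r, centre_poly P i = c%:P /\ radius_poly P ^+ 2 = r%:P.
  apply: (circle_family_moving_centre R e2 (chi i) (chi j) tau _ (centre_poly P j)) => //.
  - exact/reg2/chireg.
  - by apply: reg2; split.
  - by move=> u v ue uve; have [] := point u v ue uve.
  - move=> s se; have [] := point 0 s; rewrite ?normr0 ?add0r//.
    by move=> /(@radius_gt0 _ _ P) /lt0r_neq0.
split.
  move=> t u /(@radius_gt0 _ _ P) t0 /(@radius_gt0 _ _ P) u0.
  by apply/eqP; rewrite -(@eqrXn2 _ 2) ?ltW// -!horner_exp rhor !hornerC.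
exists (c *: delta_mx 0 i), j => t _; exists (centre_poly P j).[t].
apply/rowP => k; rewrite !mxE; have [->|->] := ij k.
  by rewrite ac hornerC !eqxx/= [i == j]eq_sym (negPf ji) mulr1 mulr0 addr0.
by rewrite !eqxx/= (negPf ji) mulr1 mulr0 add0r.
Qed.

Theorem theorem2p7 (R : realType) (d : nat) (hd : (2 <= d)%N)
    (P : sphere_family R d) (hP : regular_family P)
    (eta0 : R) (heta0 : Elekes_Szabo_exponent d.+1 eta0)
    (eta : R) (heta : eta = eta0 / 2)
    (hrich : exists C : R, 0 < C /\
      forall N : nat, exists n : nat, (N <= n)%N /\
        exists (A : 'I_d -> {fset R}) (T0 : {fset R}),
          [/\ forall i, #|` A i|%fset = n,
              #|` T0|%fset = n,
              forall t, t \in T0 -> param P t &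
              C * n%:R `^ (d%:R - eta)
                <= (grid_count (incidence_hypersurface P)
                               (grid_factors A T0))%:R]) :
  concentric P \/
  [/\ d = 2%N, fixed_radius P & centres_on_axis_parallel_line P].
Proof.
have [eta00 dichotomy] := heta0.
have [D QD] := incidence_hypersurface_semialgebraic R d P.
have [c [c0 /(_ _ QD hP.2)]] := dichotomy D.
case=> [[Qps _]|[_ /additive_form_chart[e [chi [tau [e0 chireg taureg chart]]]]]].
  have [C [C0 rich]] := hrich.
  have [N poor] := power_saving_not_rich R d c C eta0 _ c0 C0 eta00 Qps.
  have [n [Nn [A [T0 [An T0n _]]]]] := rich N.
  rewrite leNgt heta => /negP[]; apply: poor => // k.
  by rewrite /grid_factors; case: unlift.
have [d3|] := leqP 3 d.
  left; apply: (chart_concentric R d P e chi tau) => // w we se.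
  by have [] := chart w we se.
rewrite ltnS leq_eqVlt ltnNge hd orbF => /eqP d2.
subst d.
have [/forallP cst|/forallPn[j b0]] := boolP [forall j, (centre_poly P j)^`() == 0].
  left; apply: concentric_of_constant_centres => j.
  by exists (centre_poly P j)`_0; exact/deriv_eq0_const/eqP/cst.
have ji : j != rev_ord j by case: (j) => -[|[|//]].
by have [] := chart_planar R P e chi tau _ j ji e0 chireg taureg chart b0; right.
Qed.
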